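(* For every real number $K$ there exists a constant $c(K)>0$, depending only on $K$, such that the following holds. Let $N\ge 1$ be an integer and let $A\in\mathbb{R}^{N\times N}$ be a real matrix of rank $n$ such that $$\max_{1\le i,j\le N}|A_{i,j}-\delta_{i,j}|\le \frac13 ,$$ and suppose that $n\le K\log N$. Then at least $c(K)N^2$ of the entries of $A$ have absolute value strictly greater than $c(K)\,n^{-1/2}$, i.e. $$|\{(i,j)\in\{1,\dots,N\}^2\colon |A_{i,j}|>c(K)\,n^{-1/2}\}|\;\ge\; c(K)\,N^2 .$$
   Context: $\delta_{i,j}$ is the Kronecker delta (the entries of the identity matrix). $\log$ is the natural logarithm. *)

(* Defs.v *)
From mathcomp Require Export all_boot all_order all_algebra.
From mathcomp Require Export reals exp.

(* Main.v *)
(** Write f_i for the i-th row of A, V for the row space (of dimension n) and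
    t = c n^(-1/2); suppose that fewer than c N^2 entries exceed t.

    Sample m = 8n column indices J at random, with repetition.  In a sample of
    m + 1 columns the diagonal of the orthogonal projector onto the restriction
    of V has sum at most n, so few columns have leverage above 1/2; by
    exchangeability, for most i every g in V satisfies
    g(i)^2 <= sum_(a in J) g(a)^2.  For most i, moreover, |f_i| > t on a set
    P_i of at most m/H positions of J.  Fix J for which both hold for at least
    half of the i.  Since m = O(log N), there are few candidates for P_i, and
    some class S of indices with the same P_i = P has more than 64^|P| elements.

    A volume argument in dimension |P| then gives distinct i, i' in S and a
    combination k of the rows indexed by S, with coefficients of total absolute
    value at most 1/8, such that k = f_i - f_i' on P.  The function
    g = f_i - f_i' - k vanishes on P and is O(t) on the rest of J, so the
    leverage bound gives |g(i)| = O(t sqrt m) < 1/6, whereas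
    f_i(i) - f_i'(i) >= 1/3 and |k(i)| <= 1/6. *)
Require Import Defs.
From mathcomp Require Import all_boot all_order all_algebra.
From mathcomp Require Import boolp reals sequences exp.
From mathcomp Require Import ring lra zify.
Import Order.TTheory GRing.Theory Num.Theory.
Local Open Scope ring_scope.

(** * The l1 norm of row vectors *)

Definition l1norm {R : realFieldType} {n : nat} (v : 'rV[R]_n) : R :=
  \sum_i `|v 0 i|.

Lemma l1normD {R : realFieldType} {n : nat} (u v : 'rV[R]_n) :
  l1norm (u + v) <= l1norm u + l1norm v.
Proof.
by rewrite /l1norm -big_split /=; apply: ler_sum => i _; rewrite mxE ler_normD.
Qed.

Lemma l1normN {R : realFieldType} {n : nat} (v : 'rV[R]_n) :
  l1norm (- v) = l1norm v.
Proof. by apply: eq_bigr => i _; rewrite mxE normrN. Qed.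

Lemma l1normZ {R : realFieldType} {n : nat} (a : R) (v : 'rV[R]_n) :
  l1norm (a *: v) = `|a| * l1norm v.
Proof. by rewrite /l1norm mulr_sumr; apply: eq_bigr => i _; rewrite mxE normrM. Qed.

Lemma l1norm0 {R : realFieldType} {n : nat} : l1norm (0 : 'rV[R]_n) = 0.
Proof. by rewrite /l1norm big1 // => i _; rewrite mxE normr0. Qed.

Lemma l1norm_delta {R : realFieldType} {n : nat} (i : 'I_n) :
  l1norm (delta_mx 0 i : 'rV[R]_n) = 1.
Proof.
rewrite /l1norm (bigD1 i) //= mxE !eqxx normr1 big1 ?addr0 // => j ji.
by rewrite mxE (negbTE ji) andbF normr0.
Qed.

Lemma mulmx_l1norm {R : realFieldType} {m n : nat} (v : 'rV[R]_m)
    (A : 'M[R]_(m, n)) (j : 'I_n) (s : R) :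
  (forall i, `|A i j| <= s) -> `|(v *m A) 0 j| <= l1norm v * s.
Proof.
move=> As; rewrite mxE (le_trans (ler_norm_sum _ _ _)) // mulr_suml.
by apply: ler_sum => i _; rewrite normrM ler_wpM2l.
Qed.

Lemma l1norm_mulmx {R : realFieldType} {m n : nat} (v : 'rV[R]_m)
    (A : 'M[R]_(m, n)) (s : R) :
  (forall i, `|v 0 i| <= s) -> l1norm (v *m A) <= s * \sum_i \sum_j `|A i j|.
Proof.
move=> vs; rewrite exchange_big /= mulr_sumr; apply: ler_sum => j _.
rewrite mxE (le_trans (ler_norm_sum _ _ _)) // mulr_sumr.
by apply: ler_sum => i _; rewrite normrM ler_wpM2r.
Qed.

(** * Base-64 expansions and packing *)

Fixpoint digits_row (R : realFieldType) {n : nat} (s : seq 'I_n) : 'rV[R]_n :=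
  if s is i :: s' then delta_mx 0 i + 64^-1 *: digits_row R s' else 0.

Lemma l1norm_digits {R : realFieldType} {n : nat} (s : seq 'I_n) :
  l1norm (digits_row R s) <= 64 / 63.
Proof.
elim: s => [|i s IH] /=; first by rewrite l1norm0; lra.
rewrite (le_trans (l1normD _ _)) // l1norm_delta l1normZ.
by rewrite ger0_norm; lra.
Qed.

(** Common leading digits are stripped by scaling [v] by 64. At the first difference the tails
    change [v] by at most 2/63 in norm, which leaves more than 1/16 of the assumed 1/8. *)
Lemma digits_separated {R : realFieldType} {m d : nat} (U : 'M[R]_(m, d)) :
  (forall i i' (v : 'rV[R]_m), i != i' ->
     v *m U = row i U - row i' U -> 1 / 8 < l1norm v) ->
  forall (s s' : seq 'I_m) (v : 'rV[R]_m), size s = size s' -> s != s' ->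
    v *m U = (digits_row R s - digits_row R s') *m U ->
    64^-1 ^+ size s / 16 < l1norm v.
Proof.
move=> sep; elim=> [|i s IH] [|i' s'] v //= [ss'].
rewrite eqseq_cons negb_and => ne vU.
have [ii'|ii'] := eqVneq i i'.
  rewrite ii' eqxx /= in ne vU.
  have := IH s' (64 *: v) ss' ne.
  rewrite l1normZ ger0_norm ?ler0n // exprS => H.
  suff : 64^-1 ^+ size s / 16 < 64 * l1norm v by lra.
  apply: H; rewrite -scalemxAl vU opprD addrACA subrr add0r -scalerBr.
  by rewrite -scalemxAl scalerA divff ?scale1r // pnatr_eq0.
have pow1 : 64^-1 ^+ (size s).+1 <= 64^-1 :> R.
  by rewrite exprS ler_piMr ?exprn_ile1 //; lra.
set D := digits_row R s - digits_row R s'.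
have DD : l1norm D <= 128 / 63.
  rewrite (le_trans (l1normD _ _)) // l1normN.
  by have := @l1norm_digits R _ s; have := @l1norm_digits R _ s'; lra.
have := sep i i' (v - 64^-1 *: D) ii'.
have -> : (v - 64^-1 *: D) *m U = row i U - row i' U.
  rewrite mulmxBl vU !rowE -mulmxBl -mulmxBl; congr (_ *m _).
  by rewrite /D scalerBr !opprD !opprK; apply/rowP=> k; rewrite !mxE; ring.
move=> /(_ erefl) H.
have := l1normD v (- (64^-1 *: D)); rewrite l1normN l1normZ ger0_norm; lra.
Qed.

Lemma bernoulli_unbounded {R : archiRealFieldType} (a x : R) :
  1 < x -> exists n : nat, a < x ^+ n.
Proof.
move=> x1; have x1' : 0 < x - 1 by rewrite subr_gt0.
exists (Num.bound `|a / (x - 1)|).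
set n := Num.bound _.
have : a < n%:R * (x - 1).
  rewrite -ltr_pdivrMr //; apply: le_lt_trans (ler_norm _) _.
  exact/archi_boundP/normr_ge0.
move/lt_le_trans; apply.
elim: n => [|n IH]; first by rewrite mul0r expr0.
have : 1 <= x ^+ n by rewrite exprn_ege1 // ltW.
rewrite exprS -natr1; nra.
Qed.

(* The bound 64 ^ d, with no constant factor, replaces a volume comparison: a
   crude pigeonhole on the m ^ r digit expansions of length r gives
   m ^ r <= (E * 64 ^ r) ^ d, and E disappears as r grows. *)
Lemma packing {R : archiRealFieldType} {m d : nat} (U : 'M[R]_(m, d)) :
  (64 ^ d < m)%N ->
  exists i i' (v : 'rV[R]_m),
    [/\ i != i', v *m U = row i U - row i' U & l1norm v <= 1 / 8].
Proof.
move=> dm; apply: contrapT => noex.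
have sep i i' (v : 'rV[R]_m) :
    i != i' -> v *m U = row i U - row i' U -> 1 / 8 < l1norm v.
  move=> ii' vU; rewrite ltNge; apply/negP => v8.
  by apply: noex; exists i, i', v.
pose B := \sum_i \sum_j `|U i j|.
(* The pseudo-inverse writes a small vector of the row space as a combination of rows of [U] with
   comparably small coefficients. *)
pose W := pinvmx U.
pose D := (Num.trunc (2 * B)).+1.
pose C := (Num.trunc (16 * \sum_i \sum_j `|W i j|)).+1.
have UB i j : `|U i j| <= B.
  rewrite /B (bigD1 i) //= (bigD1 j) //= -addrA lerDl addr_ge0 ?sumr_ge0 //.
  by move=> *; rewrite sumr_ge0.
have DB : 2 * B < D%:R by rewrite truncnS_gt.
have CW : 16 * (\sum_i \sum_j `|W i j|) < C%:R by rewrite truncnS_gt.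
have C0 : 0 < C%:R :> R by rewrite ltr0n.
pose E := (2 * D * C).+1.
have [r Er] : exists r : nat, (E ^ d * 64 ^ (r * d) < m ^ r)%N.
  have [] := @bernoulli_unbounded R (E ^ d)%:R (m%:R / 64 ^+ d).
    by rewrite ltr_pdivlMr ?exprn_gt0 // mul1r -natrX ltr_nat.
  move=> r; rewrite expr_div_n ltr_pdivlMr ?exprn_gt0 // -exprM -!natrX -natrM.
  by rewrite ltr_nat mulnC [(d * r)%N]mulnC => H; exists r; rewrite mulnC.
(* Two expansions in one cell of side [scale^-1] differ by a combination of norm at most 64^-r / 16,
   against [digits_separated]. *)
pose scale : R := C%:R * 64 ^+ r.
have scale0 : 0 < scale by rewrite mulr_gt0 ?exprn_gt0.
pose L := (2 * D * C * 64 ^ r)%N.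
pose u (s : seq 'I_m) := digits_row R s *m U.
have uD s a : `|u s 0 a| < D%:R.
  apply: le_lt_trans (mulmx_l1norm _ _ _ _ (fun i => UB i a)) (le_lt_trans _ DB).
  have B0 : 0 <= B by rewrite sumr_ge0 // => *; rewrite sumr_ge0.
  by rewrite ler_wpM2r // (le_trans (l1norm_digits _)) //; lra.
pose cell (s : r.-tuple 'I_m) : {ffun 'I_d -> 'I_L.+1} :=
  [ffun a => inord (Num.trunc ((u s 0 a + D%:R) * scale))].
have x0 (s : seq 'I_m) (a : 'I_d) : 0 <= (u s 0 a + D%:R) * scale.
  by rewrite mulr_ge0 ?(ltW scale0) //; have := uD s a; rewrite ltr_norml; lra.
have xL (s : seq 'I_m) (a : 'I_d) : (Num.trunc ((u s 0 a + D%:R) * scale)%R < L.+1)%N.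
  rewrite ltnS -(ler_nat R); have /andP[+ _] := truncn_itv (x0 s a).
  move/le_trans; apply; rewrite !natrM natrX /scale !mulrA.
  rewrite ler_wpM2r ?exprn_ge0 // ler_wpM2r //; have := uD s a; rewrite ltr_norml; lra.
have /injectivePn[s [s' ss' cell_eq]] : ~~ injectiveb cell.
  apply/negP => /injectiveP /leq_card; apply/negP; rewrite -ltnNge.
  rewrite card_tuple card_ffun !card_ord (leq_ltn_trans _ Er) //.
  have [d0|d_gt0] := posnP d; first by rewrite [X in (_ ^ X)%N]d0 d0 muln0.
  rewrite expnM -expnMn leq_exp2r // /E mulSn /L.
  by rewrite -add1n leq_add2r expn_gt0.
pose v := (u s - u s') *m W.
have vU : v *m U = (digits_row R s - digits_row R s') *m U.
  by rewrite /v /u -mulmxBl mulmxKpV // submxMl.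
have uu a : `|(u s - u s') 0 a| <= scale^-1.
  have /ffunP/(_ a) := cell_eq; rewrite !ffunE => /(congr1 val).
  rewrite /= !inordK // => tt.
  have /andP[] := truncn_itv (x0 s a); rewrite tt => h1 h2.
  have /andP[h3 h4] := truncn_itv (x0 s' a).
  rewrite -[_^-1]mul1r ler_pdivlMr // -[scale in X in X <= _](gtr0_norm scale0).
  rewrite -natr1 in h2; rewrite -natr1 in h4.
  have -> : (u s - u s') 0 a = u s 0 a - u s' 0 a.
    by rewrite mxE [X in _ + X]mxE.
  by rewrite -normrM ler_norml mulrBl; move: h1 h2 h3 h4; rewrite !mulrDl; lra.
have := digits_separated U sep s s' v; rewrite !size_tuple => /(_ erefl ss' vU).
apply/negP; rewrite -leNgt (le_trans (l1norm_mulmx _ _ _ uu)) //.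
rewrite /scale invfM exprVn -mulrA ler_pdivrMl //.
have : 0 < 64 ^- r :> R by rewrite invr_gt0 exprn_gt0.
move: (64 ^- r) => y y0; rewrite mulrC; nra.
Qed.

(** * Orthogonal projection and leverage *)

Lemma dot_self_eq0 {R : realFieldType} {n : nat} (v : 'rV[R]_n) :
  v *m v^T = 0 -> v = 0.
Proof.
move=> /matrixP/(_ 0 0); rewrite !mxE => H; apply/rowP => j; rewrite mxE.
have /eqP := H; under eq_bigr do rewrite mxE -expr2.
rewrite psumr_eq0 => [/allP/(_ j)|i _]; last exact: sqr_ge0.
by rewrite mem_index_enum sqrf_eq0 => /(_ erefl)/eqP.
Qed.

(** For a row basis B the projector is B^T (B B^T)^-1 B. The Gram matrix is invertible, since v B
    B^T = 0 forces v B to have square sum 0; cyclicity of the trace gives the rank. *)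
Lemma row_space_projector {R : realFieldType} {p q : nat} (C : 'M[R]_(p, q)) :
  exists L : 'M[R]_q,
    [/\ L^T = L, L *m L = L, C *m L = C & \tr L = (\rank C)%:R].
Proof.
pose B := row_base C; pose G := B *m B^T.
have Gu : G \in unitmx.
  rewrite -row_free_unit.
  rewrite -kermx_eq0; apply/eqP/row_matrixP => i; rewrite row0.
  set v := row i _; have vG : v *m G = 0.
    by apply/sub_kermxP; rewrite row_sub.
  have : v *m B = 0.
    by apply: dot_self_eq0; rewrite trmx_mul mulmxA -(mulmxA v) -/G vG mul0mx.
  by move/eqP; rewrite mulmx_free_eq0 ?row_base_free // => /eqP.
have GT : G^T = G by rewrite trmx_mul trmxK.
have BL : B *m (B^T *m invmx G *m B) = B by rewrite !mulmxA -/G mulmxV // mul1mx.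
exists (B^T *m invmx G *m B); split.
- by rewrite trmx_mul (trmx_mul B^T) trmxK trmx_inv GT mulmxA.
- by rewrite -[LHS]mulmxA BL.
- have /submxP[D CD] : (C <= B)%MS by rewrite eq_row_base.
  by rewrite [X in X *m _]CD -(mulmxA D) BL -CD.
- by rewrite mxtrace_mulC mulmxA -/G mulmxV // mxtrace1.
Qed.

(* For [g = g *m L], the [a]-th equation reads
   [(1 - L a a) * g a = \sum_(b != a) g b * L b a]; the sum of squares with
   weight [2 * g a] below stands for Cauchy-Schwarz on the right-hand side. *)
Lemma high_leverage_card {R : realFieldType} {p q : nat} (C : 'M[R]_(p, q)) :
  exists2 B : {set 'I_q}, (#|B| <= 2 * \rank C)%N &
    forall a (v : 'rV[R]_p), a \notin B ->
      (v *m C) 0 a ^+ 2 <= \sum_(b | b != a) (v *m C) 0 b ^+ 2.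
Proof.
have [L [LT LL CL trL]] := row_space_projector C.
have Lsym a b : L a b = L b a by rewrite -{1}LT mxE.
have Laa a : L a a = \sum_b L b a ^+ 2.
  by rewrite -{1}LL mxE; apply: eq_bigr => b _; rewrite Lsym expr2.
(* The diagonal of [L] is nonnegative and sums to the rank. *)
exists [set a | 1 / 2 < L a a].
  rewrite -(ler_nat R) natrM -trL /mxtrace -sum1_card natr_sum mulr_sumr.
  rewrite [X in _ <= X](bigID [in [set a | 1 / 2 < L a a]]) /=.
  rewrite ler_wpDr ?sumr_ge0 // => [a _|].
    by rewrite Laa mulr_ge0 // sumr_ge0 // => b _; exact: sqr_ge0.
  by apply: ler_sum => a; rewrite inE; lra.
move=> a v; rewrite inE -leNgt => La.
set g := v *m C; have gL : g *m L = g by rewrite -mulmxA CL.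
have ga : (1 - L a a) * g 0 a = \sum_(b | b != a) g 0 b * L b a.
  have := congr1 (fun M : 'rV_q => M 0 a) gL; rewrite [LHS]mxE (bigD1 a) //= => H.
  by apply: (addrI (g 0 a * L a a)); rewrite H; ring.
have Lb : \sum_(b | b != a) L b a ^+ 2 = L a a - L a a ^+ 2.
  have := Laa a; rewrite (bigD1 a) //= => H.
  by apply: (addrI (L a a ^+ 2)); rewrite -H; ring.
have : 0 <= \sum_(b | b != a) (g 0 b - (2 * g 0 a) * L b a) ^+ 2.
  by apply: sumr_ge0 => b _; exact: sqr_ge0.
under eq_bigr => b _ do rewrite sqrrB exprMn mulrCA -mulrnAr.
rewrite big_split /= big_split /= sumrN -!mulr_sumr sumrMnl Lb -ga.
set S := \sum_(b | _) _; set x : R := L a a; set y : R := g 0 a => H.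
clear LT LL CL gL.
(* The factor equals 4 (1 - x)^2 - 1, and [H] amounts to 4 (1 - x)^2 y^2 <= S. *)
have : 0 <= (1 - 2 * x) * (3 - 2 * x) * y ^+ 2.
  by apply: mulr_ge0 (sqr_ge0 _); apply: mulr_ge0; rewrite /x; lra.
lra.
Qed.

(** * Averaging over random samples *)

Lemma reindex_ffun_lift {V : nmodType} {I : finType} {m : nat} (a : 'I_m.+1)
    (G : {ffun 'I_m -> I} -> I -> V) :
  \sum_(w : {ffun 'I_m.+1 -> I}) G [ffun b => w (lift a b)] (w a) =
  \sum_(J : {ffun 'I_m -> I}) \sum_i G J i.
Proof.
rewrite pair_big /=.
pose h (Ji : {ffun 'I_m -> I} * I) : {ffun 'I_m.+1 -> I} :=
  [ffun b => if unlift a b is Some c then Ji.1 c else Ji.2].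
pose k (w : {ffun 'I_m.+1 -> I}) := ([ffun b => w (lift a b)], w a).
rewrite (reindex h) /=; last first.
  exists k => [[J i]|w] _; rewrite /h /k /=.
    by congr pair; [apply/ffunP => b|]; rewrite !ffunE ?liftK ?unlift_none.
  by apply/ffunP => b; rewrite ffunE; case: unliftP => [c ->|->]; rewrite ?ffunE.
apply: eq_bigr => [[J i]] _; rewrite /h ffunE unlift_none /=; congr (G _ _).
by apply/ffunP => b; rewrite !ffunE liftK.
Qed.

(** Exchangeability as a double count of pairs (w, a): every position [a] contributes the same sum
    over (J, i), every word [w] at most [r]. *)
Lemma card_leave_one_out {I : finType} {m r : nat}
    (bad : {ffun 'I_m -> I} -> I -> bool) :
  (forall w : {ffun 'I_m.+1 -> I},
     #|[set a | bad [ffun b => w (lift a b)] (w a)]| <= r)%N ->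
  (m.+1 * (\sum_J \sum_i bad J i) <= r * #|I| ^ m.+1)%N.
Proof.
move=> badr.
have -> : (m.+1 * (\sum_J \sum_i bad J i) =
    \sum_(a < m.+1) \sum_(w : {ffun 'I_m.+1 -> I})
       bad [ffun b => w (lift a b)] (w a))%N.
  pose B J i := nat_of_bool (bad J i).
  rewrite [RHS](eq_bigr _ (fun a _ => @reindex_ffun_lift nat I m a B)).
  by rewrite sum_nat_const card_ord.
rewrite exchange_big /=.
have -> : (r * #|I| ^ m.+1 = \sum_(w : {ffun 'I_m.+1 -> I}) r)%N.
  by rewrite sum_nat_const card_ffun card_ord mulnC.
apply: leq_sum => w _; apply: leq_trans (badr w).
rewrite -sum1_card [leqRHS]big_mkcond /=; apply: leq_sum => a _.
by rewrite inE; case: ifP.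
Qed.

(** The expected number of hits with denominators cleared: each sampled index [J a] is uniform. *)
Lemma sum_card_hits {I : finType} {m : nat} (T : I -> I -> bool) :
  (#|I| * (\sum_(J : {ffun 'I_m -> I}) \sum_i #|[set a | T i (J a)]|) =
    m * #|[set ij : I * I | T ij.1 ij.2]| * #|I| ^ m)%N.
Proof.
have -> : #|[set ij : I * I | T ij.1 ij.2]| = (\sum_i \sum_j T i j)%N.
  rewrite pair_big /= -sum1_card big_mkcond /=.
  by apply: eq_bigr => ij _; rewrite inE; case: ifP.
have E J i : #|[set a : 'I_m | T i (J a)]| = (\sum_a T i (J a))%N.
  rewrite -sum1_card big_mkcond /=.
  by apply: eq_bigr => a _; rewrite inE; case: ifP.
have -> : (\sum_(J : {ffun 'I_m -> I}) \sum_i #|[set a | T i (J a)]| =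
    \sum_(a < m) \sum_(J : {ffun 'I_m -> I}) \sum_i T i (J a))%N.
  rewrite [RHS]exchange_big /=; apply: eq_bigr => J _.
  by rewrite [RHS]exchange_big /=; apply: eq_bigr => i _; rewrite E.
case: m E => [|m] E; first by rewrite big_ord0 muln0.
pose B (_ : {ffun 'I_m -> I}) j := (\sum_i T i j)%N.
rewrite (eq_bigr _ (fun a _ => @reindex_ffun_lift nat I m a B)).
have -> : \sum_J \sum_j B J j = (#|I| ^ m * \sum_i \sum_j T i j)%N.
  by rewrite [in RHS]exchange_big -[in RHS](card_ord m) -card_ffun -sum_nat_const.
by rewrite sum_nat_const card_ord expnS; ring.
Qed.

(** Expand (1 + x)^m as the sum of x^|P| over all P; as x <= 1, each P with at most [h] elements
    contributes at least x^h. *)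
Lemma card_small_sets {R : realFieldType} {m : nat} (h : nat) (x : R) :
  0 < x <= 1 ->
  #|[set P : {set 'I_m} | #|P| <= h]%N|%:R * x ^+ h <= (1 + x) ^+ m.
Proof.
move=> /andP[x0 x1].
have -> : (1 + x) ^+ m = \sum_(P : {set 'I_m}) x ^+ #|P|.
  have := bigA_distr 1 +%R (fun _ : 'I_m => x) (fun=> 1).
  rewrite prodr_const card_ord addrC => ->.
  apply: eq_bigr => P _; rewrite -big_mkcond /=.
  by rewrite prodr_const.
rewrite -sum1_card natr_sum mulr_suml [leLHS]big_mkcond /=.
apply: ler_sum => P _; rewrite inE mul1r; case: ifP => [Ph|_].
  by rewrite ler_wiXn2l // ltW.
by rewrite exprn_ge0 // ltW.
Qed.

(** * Existence of a good sample *)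

(** The exceptional set consists of positions, not of column indices, so repeated columns do no
    harm. *)
Lemma leave_one_out_leverage {R : realFieldType} {p q m : nat} (A : 'M[R]_(p, q))
    (w : {ffun 'I_m.+1 -> 'I_q}) :
  (#|[set a | ~~ `[< forall v : 'rV[R]_p, ((v *m A) 0 (w a) ^+ 2 <=
        \sum_b (v *m A) 0 (w (lift a b)) ^+ 2)%R >]]| <= 2 * \rank A)%N.
Proof.
have [B Br HB] := high_leverage_card (colsub w A).
apply: leq_trans (leq_trans (subset_leq_card _) Br) _; last first.
  by rewrite leq_mul2l -[in colsub w A](mulmx1 A) -mulmx_colsub mxrankM_maxl.
apply/subsetP => a; rewrite inE; apply: contraR => aB; apply/asboolP => v.
have := HB a v aB; rewrite mulmx_colsub !mxE.
suff -> : forall F : 'I_m.+1 -> R, \sum_(b | b != a) F b = \sum_b F (lift a b).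
  by move/le_trans; apply; apply: ler_sum => b _; rewrite !mxE.
move=> F; apply: (addrI (F a)); transitivity (\sum_b F b); first by rewrite [RHS](bigD1 a) //=.
  by rewrite (bigD1_ord a) //=.
Qed.

(** Each of the two kinds of bad pairs (J, i) makes up less than a quarter of all pairs, so for some
    J at most half of the i are bad. *)
Lemma good_sample {R : realFieldType} {N n H : nat} (A : 'M[R]_N)
    (T : 'I_N -> 'I_N -> bool) (m := (8 * n)%N) :
  (0 < N)%N -> (0 < n)%N -> \rank A = n ->
  (4 * H * #|[set ij : 'I_N * 'I_N | T ij.1 ij.2]| < N ^ 2)%N ->
  exists (J : {ffun 'I_m -> 'I_N}) (G : {set 'I_N}),
    [/\ (N <= 2 * #|G|)%N,
        forall i, i \in G -> forall v : 'rV[R]_N,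
          (v *m A) 0 i ^+ 2 <= \sum_a (v *m A) 0 (J a) ^+ 2 &
        forall i, i \in G -> (#|[set a | T i (J a)]| * H <= m)%N].
Proof.
move=> N0 n0 rA TN.
pose b1 (J : {ffun 'I_m -> 'I_N}) i := ~~ `[< forall v : 'rV[R]_N,
  (v *m A) 0 i ^+ 2 <= \sum_a (v *m A) 0 (J a) ^+ 2 >].
pose hit (J : {ffun 'I_m -> 'I_N}) i := #|[set a | T i (J a)]|.
pose b2 J i := (m < hit J i * H)%N.
pose B1 := (\sum_J \sum_i b1 J i)%N; pose B2 := (\sum_J \sum_i b2 J i)%N.
have B1le : (m.+1 * B1 <= 2 * n * N ^ m.+1)%N.
  rewrite -[N in (N ^ _)%N]card_ord; apply: card_leave_one_out => w.
  rewrite -rA; apply: leq_trans (leave_one_out_leverage A w).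
  apply: subset_leq_card; apply/subsetP => a; rewrite !inE.
  apply: contra => /asboolP Hv; apply/asboolP => v.
  by apply: le_trans (Hv v) _; apply: ler_sum => b _; rewrite ffunE.
(* Markov's inequality for the number of hits. *)
have B2le : (m * B2 <= H * (\sum_J \sum_i hit J i))%N.
  rewrite !big_distrr /=; apply: leq_sum => J _.
  rewrite !big_distrr /=; apply: leq_sum => i _.
  by rewrite /b2 mulnC; case: ltnP; rewrite ?mul1n ?mul0n // mulnC => /ltnW.
have := @sum_card_hits 'I_N m T; rewrite card_ord -/hit => hits.
(* The proportion is at most 2n / (8n + 1) < 1/4. *)
have B1lt : (4 * B1 < N ^ m.+1)%N.
  have : (0 < N ^ m.+1)%N by rewrite expn_gt0 N0.
  by move: B1le; rewrite /m; nia.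
have B2lt : (4 * B2 < N ^ m.+1)%N.
  have m0 : (0 < m)%N by rewrite /m; lia.
  have X0 : (0 < N ^ m)%N by rewrite expn_gt0 N0.
  have H4 : (4 * N * (m * B2) <= 4 * H * #|[set ij : 'I_N * 'I_N | T ij.1 ij.2]| * (m * N ^ m))%N.
    apply: leq_trans (leq_mul (leqnn (4 * N)%N) B2le) (eq_leq _).
    rewrite (_ : (4 * N * _ = 4 * H * (N * \sum_J \sum_i hit J i))%N); last by ring.
    by rewrite hits; ring.
  have Y0 : (0 < m * N ^ m)%N by rewrite muln_gt0 m0.
  rewrite -(ltn_pmul2r Y0) in TN.
  rewrite expnS -(ltn_pmul2l N0) -(ltn_pmul2l m0).
  rewrite (_ : (m * _ = 4 * N * (m * B2))%N); last by ring.
  by apply: leq_ltn_trans H4 (leq_trans TN (eq_leq _)); ring.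
pose G J := [set i | ~~ b1 J i && ~~ b2 J i].
have [J NG] : exists J, (N <= 2 * #|G J|)%N.
  apply: contrapT => noJ.
  have : (N ^ m.+1 <= 2 * (B1 + B2))%N.
    rewrite /B1 /B2 -big_split /= big_distrr /=.
    have -> : (N ^ m.+1 = \sum_(J : {ffun 'I_m -> 'I_N}) N)%N.
      by rewrite sum_nat_const card_ffun !card_ord expnS mulnC.
    apply: leq_sum => J _.
    have : (2 * #|G J| < N)%N by rewrite ltnNge; apply/negP => ?; apply: noJ; exists J.
    have : (#|~: G J| <= \sum_i b1 J i + \sum_i b2 J i)%N.
      rewrite -big_split /= -sum1_card big_mkcond /=; apply: leq_sum => i _.
      by rewrite !inE; case: (b1 J i); case: (b2 J i).
    have := cardsC (G J); rewrite card_ord.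
    by move: (\sum_i b1 J i)%N (\sum_i b2 J i)%N #|G J| #|~: G J| => x y z t; lia.
  lia.
exists J, (G J); split => // i; rewrite inE /b1 /b2 negbK -leqNgt => /andP[].
  by move/asboolP.
by move=> _.
Qed.

(** * Classes of rows with the same pattern *)

Lemma pigeonhole_small_sets {I : finType} {m h : nat} (G : {set I})
    (P : I -> {set 'I_m}) :
  (forall i, i \in G -> #|P i| <= h)%N ->
  (forall Q : {set 'I_m}, #|[set i in G | P i == Q]| <= 64 ^ #|Q|)%N ->
  (#|G| <= #|[set Q : {set 'I_m} | #|Q| <= h]| * 64 ^ h)%N.
Proof.
move=> Ph PQ.
rewrite -sum1_card (partition_big P [in [set Q : {set 'I_m} | #|Q| <= h]%N]) /=.
  rewrite -sum_nat_const; apply: leq_sum => Q; rewrite inE => Qh.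
  apply: leq_trans (leq_trans (PQ Q) _); last by rewrite leq_exp2l.
  by rewrite -sum1_card; apply: eq_leq; apply: eq_bigl => i; rewrite inE.
by move=> i iG; rewrite inE Ph.
Qed.

(** A larger class would allow [packing] on the columns of [Q], in dimension |Q|, and [u *m A] would
    violate the leverage bound. *)
Lemma card_pattern_class {R : archiRealFieldType} {N m : nat} (A : 'M[R]_N)
    (J : 'I_m -> 'I_N) (Q : {set 'I_m}) (S : {set 'I_N}) (t : R) :
  (forall i j, `|A i j - (i == j)%:R| <= 1 / 3) ->
  m%:R * t ^+ 2 <= 1 / 200 ->
  (forall i, i \in S -> forall v : 'rV[R]_N,
     (v *m A) 0 i ^+ 2 <= \sum_a (v *m A) 0 (J a) ^+ 2) ->
  (forall i a, i \in S -> a \notin Q -> `|A i (J a)| <= t) ->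
  (#|S| <= 64 ^ #|Q|)%N.
Proof.
move=> Aid mt lev small; rewrite leqNgt; apply/negP => QS.
pose f (k : 'I_#|S|) : 'I_N := enum_val k.
have [k [k' [v [kk' vU v8]]]] :=
  packing (\matrix_(k < #|S|, b < #|Q|) A (f k) (J (enum_val b))) QS.
set U := \matrix_(_, _) _ in vU.
pose w := v *m rowsub f A.
have wE j (s : R) : (forall k, `|A (f k) j| <= s) -> `|w 0 j| <= s / 8.
  move=> As; have s0 : 0 <= s by apply: le_trans (As k).
  apply: le_trans (mulmx_l1norm _ _ j s _) _; first by move=> l; rewrite mxE.
  by rewrite mulrC ler_wpM2l //; lra.
pose u : 'rV[R]_N := delta_mx 0 (f k) - delta_mx 0 (f k') - v *m rowsub f 1%:M.
have uE j : (u *m A) 0 j = A (f k) j - A (f k') j - w 0 j.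
  rewrite /u mulmxBl -mulmxA mul_rowsub_mx mul1mx -/w mulmxBl -!rowE.
  by rewrite mxE [X in X + _]mxE [X in _ + X + _]mxE [X in _ + X]mxE !(mxE _ _ 0 j).
have [fk fk'] : f k \in S /\ f k' \in S by rewrite !enum_valP.
have fkk' : f k != f k' by rewrite (inj_eq enum_val_inj).
(* Off [Q], 17/8 = 1 + 1 + 1/8 from two rows and the combination [w]; on [Q] the value is 0. *)
have uJ a : (u *m A) 0 (J a) ^+ 2 <= (17 / 8) ^+ 2 * t ^+ 2.
  have [aQ|aQ] := boolP (a \in Q).
    have vUa := congr1 (fun M : 'rV_ _ => M 0 (enum_rank_in aQ a)) vU.
    rewrite /= !mxE enum_rankK_in // in vUa.
    have -> : (u *m A) 0 (J a) = 0.
      rewrite uE -vUa /w mxE -sumrB big1 // => l _.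
      by rewrite !mxE enum_rankK_in // subrr.
    by rewrite expr0n /= mulr_ge0 // sqr_ge0.
  have h l : `|A (f l) (J a)| <= t by apply: small aQ; rewrite enum_valP.
  have := wE _ _ h; have := h k; have := h k'.
  rewrite uE -exprMn !ler_norml => /andP[h1 h2] /andP[h3 h4] /andP[h5 h6].
  by rewrite -subr_ge0 subr_sqr; apply: mulr_ge0; lra.
(* At least 2/3 from the diagonal entry, less 1/3 for the other row and (4/3)/8 = 1/6 for [w]. *)
have ui : 1 / 6 <= (u *m A) 0 (f k).
  have h j l : `|A (f l) j| <= 4 / 3.
    have := Aid (f l) j; rewrite !ler_norml => /andP[].
    by case: eqP => _ /=; rewrite ?mulr1n ?mulr0n => *; apply/andP; split; lra.
  have := wE (f k) _ (h (f k)); have := Aid (f k) (f k); have := Aid (f k') (f k).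
  rewrite uE eqxx eq_sym (negbTE fkk') !ler_norml /=.
  by move=> /andP[h1 h2] /andP[h3 h4] /andP[h5 h6]; lra.
have := lev _ fk u; apply/negP; rewrite -ltNge.
apply: (@le_lt_trans _ _ (\sum_(a < m) ((17 / 8) ^+ 2 * t ^+ 2))).
  by apply: ler_sum => a _; exact: uJ.
(* (17/8)^2 / 200 < 1/36. *)
rewrite sumr_const card_ord -mulr_natl; nra.
Qed.

(** The subsets are counted with x = 1/X; then 1 + y <= e^y is used at y = 1/X and at y = 64 X. *)
Lemma card_patterns_expR {R : realType} (X m h : nat) : (0 < X)%N ->
  (#|[set Q : {set 'I_m} | #|Q| <= h]| * 64 ^ h)%N%:R <=
    expR (64 * X%:R * h%:R + m%:R / X%:R) :> R.
Proof.
move=> X0; have X0' : 0 < X%:R :> R by rewrite ltr0n.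
have := @card_small_sets R m h X%:R^-1; rewrite invr_gt0 X0' invf_le1 // ler1n X0.
move=> /(_ erefl); rewrite exprVn ler_pdivrMr ?exprn_gt0 // => H.
rewrite natrM natrX; apply: (@le_trans _ _ ((1 + X%:R^-1) ^+ m * X%:R ^+ h * 64 ^+ h)).
  by rewrite ler_wpM2r ?exprn_ge0.
have -> : expR (64 * X%:R * h%:R + m%:R / X%:R) =
    expR X%:R^-1 ^+ m * expR (64 * X%:R) ^+ h :> R.
  by rewrite -!expRM_natr -expRD; congr expR; ring.
have e1 : 1 + X%:R^-1 <= expR X%:R^-1 :> R by exact: expR_ge1Dx.
have e2 : X%:R * 64 <= expR (64 * X%:R) :> R.
  by apply: le_trans (expR_ge1Dx _); rewrite mulrC; lra.
have X0i : 0 <= X%:R^-1 :> R by rewrite invr_ge0 ltW.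
have ge1 : 0 <= 1 + X%:R^-1 :> R by rewrite addr_ge0.
have ge2 : 0 <= X%:R * 64 :> R by rewrite mulr_ge0.
by rewrite -mulrA -exprMn; apply: ler_pM; rewrite ?exprn_ge0 // lerXn2r // nnegrE expR_ge0.
Qed.

(** * Choice of the constants and the final contradiction *)

Theorem corollary1 (R : realType) (K : R) :
  exists2 c : R, 0 < c &
    forall (N n : nat) (A : 'M[R]_N),
      (1 <= N)%N ->
      \rank A = n ->
      (forall i j : 'I_N, `|A i j - (i == j)%:R| <= 1 / 3) ->
      n%:R <= K * ln (N%:R : R) ->
      c * N%:R ^+ 2 <=
        #|[set ij : 'I_N * 'I_N | `|A ij.1 ij.2| > c * n%:R `^ (- (1 / 2))]|%:R.
Proof.
(* X >= 32 K makes each of the two exponents in card_patterns_expR at most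
   (ln N) / 4, so that N <= 2 sqrt N. *)
pose X := (Num.trunc (32 * K)).+1; pose H := (64 * X ^ 2)%N.
have KX : 32 * K <= X%:R by rewrite ltW // truncnS_gt.
have X1 : (0 < X)%N by [].
have H64 : (64 <= H)%N by rewrite leq_pmulr // expn_gt0.
have H64' : 64 <= H%:R :> R by rewrite (ler_nat R 64).
(* This [c] turns the assumption of few large entries into the hypothesis 4 H |T| < N^2 of
   [good_sample]. *)
pose c : R := (4 * H%:R)^-1.
have c0 : 0 < c by rewrite invr_gt0; lra.
have c256 : c <= 1 / 256 by rewrite div1r lef_pV2 ?posrE; lra.
exists c => // N n A N1 rA Aid nK.
have n0 : (0 < n)%N.
  rewrite lt0n -rA mxrank_eq0; apply/eqP => A0.
  have := Aid (Ordinal N1) (Ordinal N1); rewrite A0 mxE eqxx.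
  by rewrite ler_norml /=; lra.
have n0' : 1 <= n%:R :> R by rewrite ler1n.
set t := c * (_ `^ _).
have t0 : 0 <= t by rewrite mulr_ge0 ?powR_ge0 // ltW.
have t2 : n%:R * t ^+ 2 = c ^+ 2.
  rewrite /t exprMn powRN div1r powR12_sqrt // (exprVn (Num.sqrt _)) sqr_sqrtr // mulrCA.
  by rewrite divff ?mulr1 //; lra.
have tc : t <= c.
  by rewrite -(@ler_pXn2r _ 2) ?nnegrE // ?(ltW c0) // -t2 ler_peMl ?sqr_ge0.
pose T i j := t < `|A i j|.
have Tii i : T i i.
  have := Aid i i; rewrite eqxx ler_norml /= => /andP[h _].
  by apply: lt_le_trans (ler_norm _); lra.
rewrite leNgt; apply/negP => few.
(* The final bound N <= 2 sqrt N only excludes N > 4. For smaller N the N diagonal entries suffice,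
   as c N^2 < N. *)
have N4 : (4 < N)%N.
  rewrite ltnNge; apply/negP => N4; have N4' : N%:R <= 4 :> R by rewrite (ler_nat R N 4).
  suff : (N <= #|[set ij : 'I_N * 'I_N | (t < `|A ij.1 ij.2|)%R]|)%N.
    rewrite -(ler_nat R) => h; have : 1 <= N%:R :> R by rewrite ler1n.
    by nra.
  rewrite -{1}(card_ord N) -(card_imset predT (f := fun i => (i, i))); last by move=> i j [].
  by apply/subset_leq_card/subsetP => _ /imsetP[i _ ->]; rewrite inE; exact: Tii.
have few' : (4 * H * #|[set ij : 'I_N * 'I_N | T ij.1 ij.2]| < N ^ 2)%N.
  rewrite -(ltr_nat R) natrX 2!natrM; move: few; rewrite /c mulrC ltr_pdivlMr; last by lra.
  by rewrite mulrC.
have [J [G [NG lev hits]]] := good_sample A T N1 n0 rA few'.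
set m := (8 * n)%N in J lev hits.
pose h := (m %/ H)%N.
have : (#|G| <= #|[set Q : {set 'I_m} | #|Q| <= h]| * 64 ^ h)%N.
  apply: (@pigeonhole_small_sets _ _ _ G (fun i => [set a | T i (J a)])).
    by move=> i iG; rewrite leq_divRL ?hits //; lia.
  move=> Q; apply: (@card_pattern_class _ _ _ A J _ _ t) => //.
  - by rewrite natrM -mulrA t2; nra.
  - by move=> i; rewrite inE => /andP[iG _]; exact: lev.
  - move=> i a; rewrite inE => /andP[_ /eqP <-].
    by rewrite inE -leNgt.
move=> Gle; have : (N <= 2 * (#|[set Q : {set 'I_m} | #|Q| <= h]| * 64 ^ h))%N by lia.
rewrite -(ler_nat R) natrM => Nle.
have X0 : 0 < X%:R :> R by rewrite ltr0n.
have NlnN : expR (ln N%:R) = N%:R :> R by rewrite lnK // posrE ltr0n.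
have lnN0 : 0 <= ln N%:R :> R by rewrite ln_ge0 // ler1n.
(* As H = 64 X^2, h H <= m makes the first exponent at most the second, 8n/X, which is at most (ln
   N)/4 by 32 n <= X ln N. *)
have expo : 64 * X%:R * h%:R + m%:R / X%:R <= ln N%:R / 2 :> R.
  have : (h * H)%:R <= m%:R :> R by rewrite ler_nat leq_trunc_div.
  rewrite /H 2!natrM natrX !natrM => hH.
  have -> : 64 * X%:R * h%:R + 8 * n%:R / X%:R =
      (h%:R * (64 * X%:R ^+ 2) + 8 * n%:R) / X%:R :> R by field; lra.
  by rewrite ler_pdivrMr //; nra.
have := le_trans (@card_patterns_expR R X m h X1) (_ : _ <= expR (ln N%:R / 2)).
rewrite ler_expR => /(_ expo) cardle.
have e2 : expR (ln N%:R / 2) ^+ 2 = N%:R :> R.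
  by rewrite -expRM_natr divfK ?pnatr_eq0.
have N5 : 5 <= N%:R :> R by rewrite (ler_nat R 5).
have := expR_ge0 (ln (N%:R : R) / 2); nra.
Qed.
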